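(* Let $(X,X_+,\mathcal K,f)$ be a strong abstract state space and let $\mathcal T=(T_t)_{t\ge0}$ be a $C_0$-Markov semigroup on $X$ such that $\delta(A_{t_0}(\mathcal T))<1$ for some $t_0>0$. Let $x_0\in\mathcal K$ be the unique fixed point of $\mathcal T$ in $\mathcal K$. Then every $C_0$-Markov semigroup $\mathcal S=(S_t)_{t\ge0}$ on $X$ satisfying $$\|A_{t_0}(\mathcal S)-A_{t_0}(\mathcal T)\|<1-\delta(A_{t_0}(\mathcal T))$$ is uniformly mean ergodic and has a unique fixed point $z_0\in\mathcal K$, and $$\|x_0-z_0\|\le\frac{\|A_{t_0}(\mathcal S)-A_{t_0}(\mathcal T)\|}{1-\delta(A_{t_0}(\mathcal T))-\|A_{t_0}(\mathcal S)-A_{t_0}(\mathcal T)\|}.$$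
   Context: Abstract state space $(X,X_+,\mathcal K,f)$: $X$ is a real vector space ordered by a generating cone $X_+$ (so $X=X_+-X_+$), $f$ is a linear functional on $X$ with $f(x)>0$ for all $x\in X_+\setminus\{0\}$, and $\mathcal K=\{x\in X_+: f(x)=1\}$. Let $U$ be the convex hull of $\mathcal K\cup(-\mathcal K)$ and $\|x\|=\inf\{\lambda\ge0: x\in\lambda U\}$. It is assumed that $\|\cdot\|$ is a norm, that $X$ is complete for it, and that $X_+$ is closed. Norms of operators are operator norms. The abstract state space is strong if $U$ is radially compact, i.e. $\ell\cap U$ is a closed and bounded segment for every line $\ell$ through the origin; equivalently, $U$ is the closed unit ball of $X$. A linear operator $T:X\to X$ is Markov if it is positive ($Tx\ge0$ whenever $x\ge 0$) and $T(\mathcal K)\subset\mathcal K$. A $C_0$-Markov semigroup is a strongly continuous one-parameter semigroup $(T_t)_{t\ge0}$ on $X$ ($T_0=I$, $T_{t+s}=T_tT_s$, $\|T_tx-x\|\to0$ as $t\downarrow0$ for every $x\in X$) such that every $T_t$ is Markov. A fixed point of the semigroup is an $x\in X$ with $T_tx=x$ for all $t\ge0$. Averages: $A_t(\mathcal T)=\frac1t\int_0^tT_s\,ds$ for $t>0$, the integral being taken in the strong operator topology; similarly for $\mathcal S$. $\mathcal S$ is uniformly mean ergodic if there is $y_0\in\mathcal K$ such that $A_t(\mathcal S)$ converges in operator norm, as $t\to\infty$, to the operator $x\mapsto f(x)y_0$. (If $\delta(A_{t_0}(\mathcal T))<1$ for some $t_0>0$, then $\mathcal T$ is uniformly mean ergodic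 and has a unique fixed point in $\mathcal K$.) Dobrushin's ergodicity coefficient of a Markov operator $T$: with $N=\{x\in X: f(x)=0\}$, $\delta(T)=\sup_{x\in N,\,x\ne0}\|Tx\|/\|x\|$. *)

(* Defs.v *)
From Stdlib Require Import Reals.
From Coquelicot Require Import Coquelicot.

Open Scope R_scope.

Definition linear_map {V W : ModuleSpace R_Ring} (T : V -> W) : Prop :=
  (forall x y : V, T (plus x y) = plus (T x) (T y)) /\
  (forall (a : R) (x : V), T (scal a x) = scal a (T x)).

Definition convex_set {V : ModuleSpace R_Ring} (C : V -> Prop) : Prop :=
  forall (x y : V) (a : R), C x -> C y -> 0 <= a <= 1 ->
    C (plus (scal a x) (scal (1 - a) y)).

Definition convex_hull {V : ModuleSpace R_Ring} (A : V -> Prop) (x : V) : Prop :=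
  forall C : V -> Prop, convex_set C -> (forall y, A y -> C y) -> C x.

(** [real] sends infinite suprema to 0.  This does not matter for the operators
    to which [op_norm] and [dobrushin] are applied: Markov operators are
    contractions, so averages of Markov operators, and their differences with
    each other or with [x |-> f(x) y], are bounded.  In [dobrushin] the
    supremum over an empty index set (kernel of [f] trivial) is 0. *)
Definition op_norm {V : NormedModule R_AbsRing} (T : V -> V) : R :=
  real (Lub_Rbar (fun r => exists x : V, norm x <= 1 /\ r = norm (T x))).

Definition dobrushin {V : NormedModule R_AbsRing} (f : V -> R) (T : V -> V) : R :=
  real (Lub_Rbar (fun r =>
    exists x : V, f x = 0 /\ x <> zero /\ r = norm (T x) / norm x)).

Section AbstractStateSpace.

Context {X : CompleteNormedModule R_AbsRing} (P : X -> Prop) (f : X -> R).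

Definition state_base (x : X) : Prop := P x /\ f x = 1.

Definition state_ball : X -> Prop :=
  convex_hull (fun x : X => state_base x \/ state_base (opp x)).

(** The carrier [X] comes with a complete norm; [ass_norm] says that it is the
    gauge of [state_ball].  Pointedness of the cone follows from [ass_pos].
    The infimum being finite, the base is nonempty. *)
Record abstract_state_space : Prop := {
  ass_cone_zero : P zero;
  ass_cone_plus : forall x y : X, P x -> P y -> P (plus x y);
  ass_cone_scal : forall (a : R) (x : X), 0 <= a -> P x -> P (scal a x);
  ass_generating : forall x : X, exists y z : X, P y /\ P z /\ x = minus y z;
  ass_linear : linear_map (V := X) (W := R_ModuleSpace) f;
  ass_pos : forall x : X, P x -> x <> zero -> 0 < f x;
  ass_norm : forall x : X,
    is_glb_Rbar (fun l => 0 <= l /\ exists u : X, state_ball u /\ x = scal l u)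
      (Finite (norm x));
  ass_closed : closed P
}.

(** Each line through the origin is parametrized as [s |-> s v]. *)
Definition radially_compact (U : X -> Prop) : Prop :=
  forall v : X, v <> zero ->
    exists a b : R, forall s : R, U (scal s v) <-> a <= s <= b.

Definition strong_abstract_state_space : Prop :=
  abstract_state_space /\ radially_compact state_ball.

Definition markov (T : X -> X) : Prop :=
  linear_map T /\
  (forall x : X, P x -> P (T x)) /\
  (forall x : X, state_base x -> state_base (T x)).

(** A semigroup is a family indexed by [R], constrained only at [t >= 0]. *)
Record C0_markov_semigroup (T : R -> X -> X) : Prop := {
  c0m_zero : forall x : X, T 0 x = x;
  c0m_add : forall (t s : R) (x : X), 0 <= t -> 0 <= s -> T (t + s) x = T t (T s x);
  c0m_cont : forall x : X,
    filterlim (fun t => norm (minus (T t x) x)) (at_right 0) (locally 0);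
  c0m_markov : forall t : R, 0 <= t -> markov (T t)
}.

(** The integral of the orbit [s |-> T s x] in the Banach space [X]. *)
Definition average (T : R -> X -> X) (t : R) (x : X) : X :=
  scal (/ t) (RInt (fun s => T s x) 0 t).

Definition fixed_point (T : R -> X -> X) (x : X) : Prop :=
  forall t : R, 0 <= t -> T t x = x.

Definition unique_fixed_state (T : R -> X -> X) (x : X) : Prop :=
  unique (fun y => state_base y /\ fixed_point T y) x.

Definition uniformly_mean_ergodic (T : R -> X -> X) : Prop :=
  exists y0 : X, state_base y0 /\
    is_lim (fun t => op_norm (fun x : X => minus (average T t x) (scal (f x) y0)))
      p_infty (Finite 0).

End AbstractStateSpace.

(* Main.v *)
(** With [A], [B] the averages of [S], [T] at [t0], [eta] the norm of [A - B] and
    [delta] the coefficient of [B], the operator [A] contracts the kernel of [f]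
    by [q = delta + eta < 1].  Hence [A] has a unique fixed state [z0]; every
    [S t] commutes with [A], so it fixes [z0].  The bound follows from
    [x0 - z0 = (B - A) x0 + A (x0 - z0)].  For ergodicity, the average [A_t] of
    [S] satisfies [norm (A_t (w - A w)) <= 2 t0 / t * norm w] by cancellation of
    integrals; iterating [A_t w = A_t (w - A w) + A_t (A w)] on the kernel gives
    [norm (A_t w) <= 2 t0 / (t (1 - q)) * norm w]. *)
Require Import Defs.
From Stdlib Require Import Reals Lra Lia.
From Coquelicot Require Import Coquelicot.
Open Scope R_scope.

(** * Riemann integrals under bounded linear maps and in closed cones *)

Lemma Riemann_sum_linear {V W : NormedModule R_AbsRing} (l : V -> W) (g : R -> V)
    (s : SF_seq) :
  is_linear l -> Riemann_sum (fun x => l (g x)) s = l (Riemann_sum g s).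
Proof.
  intros Hl; induction s using SF_cons_ind.
  - symmetry; exact (linear_zero l Hl).
  - rewrite !Riemann_sum_cons, IHs, (linear_plus l Hl), (linear_scal l Hl).
    reflexivity.
Qed.

Lemma is_RInt_linear {V W : NormedModule R_AbsRing} (l : V -> W) (g : R -> V)
    (a b : R) (v : V) :
  is_linear l -> is_RInt g a b v -> is_RInt (fun x => l (g x)) a b (l v).
Proof.
  intros Hl Hg; unfold is_RInt.
  apply filterlim_ext with (fun s => l (scal (sign (b - a)) (Riemann_sum g s))).
  - intros s; rewrite (Riemann_sum_linear l g) by exact Hl. apply (linear_scal l Hl).
  - apply filterlim_comp with (2 := linear_cont l v Hl); exact Hg.
Qed.

(** A pointed subdivision has nonnegative steps, so the sum is a conic combination of values of [g]
    at points between the first and last nodes. *)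
Lemma Riemann_sum_cone {V : ModuleSpace R_Ring} (C : V -> Prop) (g : R -> V)
    (s : SF_seq) :
  C zero -> (forall x y, C x -> C y -> C (plus x y)) ->
  (forall (a : R) x, 0 <= a -> C x -> C (scal a x)) ->
  pointed_subdiv s ->
  (forall t, SF_h s <= t <= seq.last (SF_h s) (SF_lx s) -> C (g t)) ->
  C (Riemann_sum g s).
Proof.
  intros C0 Cp Cs; induction s using SF_cons_ind; intros Hs Hg.
  - exact C0.
  - rewrite Riemann_sum_cons.
    pose proof (Hs O ltac:(rewrite SF_size_cons; lia)) as H0; simpl in H0.
    assert (Hlast : SF_h s <= seq.last (SF_h s) (SF_lx s)).
    { apply (sorted_last (SF_lx s) 0).
      - apply ptd_sort, (ptd_cons h), Hs.
      - unfold SF_lx; simpl; lia. }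
    apply Cp.
    + apply Cs; [lra|]. apply Hg; simpl in *; lra.
    + apply IHs; [exact (ptd_cons _ _ Hs)|].
      intros t Ht; apply Hg; simpl in *; lra.
Qed.

(** Riemann sums stay in the cone and closedness passes this to their limit. This yields positivity
    of the averages. *)
Lemma is_RInt_cone {V : NormedModule R_AbsRing} (C : V -> Prop) (g : R -> V)
    (a b : R) (v : V) :
  C zero -> (forall x y, C x -> C y -> C (plus x y)) ->
  (forall (c : R) x, 0 <= c -> C x -> C (scal c x)) -> closed C ->
  a < b -> (forall t, a <= t <= b -> C (g t)) -> is_RInt g a b v -> C v.
Proof.
  intros C0 Cp Cs Ccl Hab Hg Hv.
  unfold is_RInt in Hv.
  refine (closed_filterlim_loc _ C v Hv _ Ccl).
  exists (mkposreal _ Rlt_0_1); intros s _ [Hs [Ha Hb]].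
  rewrite Rmin_left in Ha by lra; rewrite Rmax_right in Hb by lra.
  rewrite sign_eq_1 by lra.
  apply Cs; [lra|].
  apply Riemann_sum_cone; auto.
  intros t Ht; apply Hg; rewrite <- Ha, <- Hb; exact Ht.
Qed.

(** * Suprema with a finite value *)

(** An upper bound together with a member forces the supremum to be finite, so [real] returns it and
    not the default 0. *)
Lemma le_real_Lub (E : R -> Prop) (M r : R) :
  (forall s, E s -> s <= M) -> E r -> r <= real (Lub_Rbar E).
Proof.
  intros HM Hr; destruct (Lub_Rbar_correct E) as [Hub Hleast].
  specialize (Hub r Hr); specialize (Hleast (Finite M) HM).
  destruct (Lub_Rbar E); simpl in *; tauto.
Qed.

Lemma real_Lub_le (E : R -> Prop) (M r : R) :
  (forall s, E s -> s <= M) -> E r -> real (Lub_Rbar E) <= M.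
Proof.
  intros HM Hr; destruct (Lub_Rbar_correct E) as [Hub Hleast].
  specialize (Hub r Hr); specialize (Hleast (Finite M) HM).
  destruct (Lub_Rbar E); simpl in *; tauto.
Qed.

(** * Identities in abelian groups and norm inequalities *)

Lemma plus_minus_cancel {G : AbelianGroup} (x y : G) : plus (minus x y) y = x.
Proof.
  rewrite <- (minus_zero_r y) at 2; rewrite <- (minus_zero_r x) at 2.
  symmetry; exact (minus_trans y x zero).
Qed.

(** Serves to compare two splittings of the same integral. *)
Lemma minus_eq_minus {G : AbelianGroup} (a b c d : G) :
  plus a b = plus c d -> minus a d = minus c b.
Proof.
  intros H; apply (plus_reg_r (plus d b)).
  transitivity (plus a b).
  - rewrite plus_assoc; exact (f_equal (fun u => plus u b) (plus_minus_cancel a d)).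
  - rewrite (plus_comm d b), plus_assoc; refine (eq_trans H (eq_sym _)).
    exact (f_equal (fun u => plus u d) (plus_minus_cancel c b)).
Qed.

Lemma minus_plus_plus {G : AbelianGroup} (a b c d : G) :
  minus (plus a b) (plus c d) = plus (minus a c) (minus b d).
Proof.
  transitivity (plus (plus a b) (plus (opp c) (opp d))).
  - exact (f_equal (plus (plus a b)) (opp_plus c d)).
  - change (plus (plus a b) (plus (opp c) (opp d))
      = plus (plus a (opp c)) (plus b (opp d))).
    rewrite <- !plus_assoc; f_equal; rewrite !plus_assoc; f_equal; apply plus_comm.
Qed.

Lemma norm_minus_sym {V : CompleteNormedModule R_AbsRing} (x y : V) :
  norm (minus x y) = norm (minus y x).
Proof. rewrite <- opp_minus; exact (norm_opp (minus y x)). Qed.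

Lemma norm_minus_triangle {V : CompleteNormedModule R_AbsRing} (y x z : V) :
  norm (minus x z) <= norm (minus x y) + norm (minus y z).
Proof. rewrite (minus_trans y x z); exact (norm_triangle _ _). Qed.

Lemma norm_minus_le {V : CompleteNormedModule R_AbsRing} (x y : V) :
  norm (minus x y) <= norm x + norm y.
Proof. rewrite <- (norm_opp y); exact (norm_triangle x (opp y)). Qed.

Lemma norm_scal_nonneg {V : CompleteNormedModule R_AbsRing} (a : R) (x : V) :
  0 <= a -> norm (scal a x) <= a * norm x.
Proof.
  intros Ha; rewrite <- (Rabs_pos_eq a Ha) at 2; exact (norm_scal a x).
Qed.

(** Apply the upper bound for scalar multiples to [x = scal (/ a) (scal a x)]. *)
Lemma norm_scal_inv {V : CompleteNormedModule R_AbsRing} (a : R) (x : V) :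
  0 < a -> a * norm x <= norm (scal a x).
Proof.
  intros Ha.
  assert (H : x = scal (/ a) (scal a x)).
  { rewrite scal_assoc. change (mult (/ a) a) with (/ a * a).
    rewrite Rinv_l by lra; symmetry; exact (scal_one x). }
  apply Rmult_le_reg_l with (/ a); [now apply Rinv_0_lt_compat|].
  rewrite <- Rmult_assoc, Rinv_l, Rmult_1_l by lra.
  rewrite H at 1; apply norm_scal_nonneg, Rlt_le, Rinv_0_lt_compat, Ha.
Qed.

(* Restated because [rewrite] does not identify the coercion paths from
   [CompleteNormedModule] with those from its substructures. *)
Lemma scal_minus {V : CompleteNormedModule R_AbsRing} (a : R) (x y : V) :
  scal a (minus x y) = minus (G := V) (scal a x) (scal a y).
Proof. exact (scal_minus_distr_l a x y). Qed.

Lemma linear_map_zero {V W : CompleteNormedModule R_AbsRing} (T : V -> W) :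
  linear_map T -> T zero = zero.
Proof.
  intros [_ Hs].
  exact (eq_trans (f_equal T (eq_sym (scal_zero_l (zero : V))))
    (eq_trans (Hs zero zero) (scal_zero_l (T zero)))).
Qed.

Lemma linear_map_opp {V W : CompleteNormedModule R_AbsRing} (T : V -> W) (x : V) :
  linear_map T -> T (opp x) = opp (T x).
Proof.
  intros [_ Hs].
  exact (eq_trans (f_equal T (eq_sym (scal_opp_one x)))
    (eq_trans (Hs (opp one) x) (scal_opp_one (T x)))).
Qed.

Lemma linear_map_minus {V W : CompleteNormedModule R_AbsRing} (T : V -> W) (x y : V) :
  linear_map T -> T (minus x y) = minus (T x) (T y).
Proof.
  intros HT.
  exact (eq_trans (proj1 HT x (opp y))
    (f_equal (plus (T x)) (linear_map_opp T y HT))).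
Qed.

Lemma norm_pos {V : CompleteNormedModule R_AbsRing} (x : V) :
  x <> zero -> 0 < norm x.
Proof.
  intros Hx; destruct (norm_ge_0 x) as [|H]; [assumption|].
  elim Hx; exact (norm_eq_zero x (eq_sym H)).
Qed.

(** * Bounds through the operator norm and Dobrushin's coefficient *)

Section OperatorNorm.

Context {V : CompleteNormedModule R_AbsRing} (T : V -> V).

Lemma op_norm_ge0 (C : R) :
  (forall x, norm (T x) <= C * norm x) -> 0 <= C -> 0 <= op_norm T.
Proof.
  intros HC C0; apply Rle_trans with (norm (T zero)); [apply norm_ge_0|].
  apply (le_real_Lub _ C).
  - intros s [x [Hx ->]]; specialize (HC x). nra.
  - exists zero; split; [rewrite norm_zero; lra|reflexivity].
Qed.

Lemma op_norm_le (C : R) :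
  (forall x, norm (T x) <= C * norm x) -> 0 <= C -> op_norm T <= C.
Proof.
  intros HC C0; apply (real_Lub_le _ C (norm (T zero))).
  - intros s [x [Hx ->]]; specialize (HC x). nra.
  - exists zero; split; [rewrite norm_zero; lra|reflexivity].
Qed.

Lemma norm_le_op_norm (C : R) (x : V) :
  linear_map T -> (forall x, norm (T x) <= C * norm x) -> 0 <= C ->
  norm (T x) <= op_norm T * norm x.
Proof.
  intros [_ Hs] HC C0.
  destruct (Req_dec (norm x) 0) as [H0|H0].
  { specialize (HC x); rewrite H0 in *; lra. }
  assert (Hx : 0 < norm x) by (pose proof (norm_ge_0 x); lra).
  (* Normalizing [x] puts it in the unit ball, over which the supremum is taken. *)
  assert (H : norm (T (scal (/ norm x) x)) <= op_norm T).
  { apply (le_real_Lub _ C).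
    - intros s [y [Hy ->]]; specialize (HC y). nra.
    - eexists; split; [|reflexivity].
      apply Rle_trans with (/ norm x * norm x).
      + apply norm_scal_nonneg, Rlt_le, Rinv_0_lt_compat, Hx.
      + rewrite Rinv_l; lra. }
  rewrite Hs in H.
  pose proof (norm_scal_inv (/ norm x) (T x) (Rinv_0_lt_compat _ Hx)) as H1.
  apply Rmult_le_reg_l with (/ norm x); [now apply Rinv_0_lt_compat|].
  rewrite (Rmult_comm (op_norm T)), <- Rmult_assoc, Rinv_l, Rmult_1_l by lra.
  lra.
Qed.

Lemma dobrushin_ge0 (f : V -> R) (C : R) :
  (forall x, norm (T x) <= C * norm x) -> 0 <= dobrushin f T.
Proof.
  intros HC.
  destruct (Classical_Prop.classic (exists x, f x = 0 /\ x <> zero)) as [[x [fx x0]]|Hn].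
  - pose proof (norm_pos x x0) as Hx.
    apply Rle_trans with (norm (T x) / norm x).
    + apply Rmult_le_pos; [apply norm_ge_0|now apply Rlt_le, Rinv_0_lt_compat].
    + apply (le_real_Lub _ C); [|now exists x].
      intros s [y [_ [y0 ->]]]; apply Rle_div_l; [exact (norm_pos y y0)|apply HC].
  - unfold dobrushin.
    (* The kernel of [f] is trivial here: the supremum over the empty set is [m_infty], which [real]
       sends to 0. *)
    rewrite (is_lub_Rbar_unique _ m_infty); [apply Rle_refl|].
    split; [|intros b _; exact I].
    intros s [y [fy [y0 _]]]; elim Hn; now exists y.
Qed.

Lemma norm_le_dobrushin (f : V -> R) (C : R) (x : V) :
  (forall x, norm (T x) <= C * norm x) -> f x = 0 ->
  norm (T x) <= dobrushin f T * norm x.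
Proof.
  intros HC fx.
  destruct (norm_ge_0 x) as [Hx|Hx].
  - apply Rle_div_l; [exact Hx|].
    apply (le_real_Lub _ C).
    + intros s [y [_ [y0 ->]]]; apply Rle_div_l; [exact (norm_pos y y0)|apply HC].
    + exists x; repeat split; [exact fx|].
      intros ->; rewrite norm_zero in Hx; lra.
  - specialize (HC x); rewrite <- Hx in *; lra.
Qed.

End OperatorNorm.

(** * The contraction principle on a closed set *)

(** Picard iteration. Contraction is asked only between points of [D], since it will be applied to
    states, whose differences lie in the kernel of [f]. *)
Lemma contraction_fixed_point {V : CompleteNormedModule R_AbsRing} (D : V -> Prop)
    (A : V -> V) (q : R) (x : V) :
  closed D -> 0 <= q < 1 -> D x -> (forall y, D y -> D (A y)) ->
  (forall y z, D y -> D z -> norm (minus (A y) (A z)) <= q * norm (minus y z)) ->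
  exists z, D z /\ A z = z.
Proof.
  intros Dcl Hq Dx DA HA.
  set (u n := Nat.iter n A x).
  assert (Du : forall n, D (u n)) by (induction n; simpl; auto).
  (* Sum of the geometric series of step bounds. It solves [norm (minus (A x) x) + q * M = M], which
     closes the induction for [H1]. *)
  set (M := norm (minus (A x) x) / (1 - q)).
  assert (HM : norm (minus (A x) x) = M * (1 - q)) by (unfold M; field; lra).
  assert (M0 : 0 <= M).
  { apply Rmult_le_pos; [apply norm_ge_0|apply Rlt_le, Rinv_0_lt_compat; lra]. }
  assert (H1 : forall k, norm (minus (u k) x) <= M).
  { induction k.
    - replace (norm (minus (u O) x)) with 0; [exact M0|].
      simpl; rewrite minus_eq_zero; symmetry; exact norm_zero.
    - pose proof (norm_minus_triangle (A x) (u (S k)) x).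
      pose proof (HA (u k) x (Du k) Dx). change (A (u k)) with (u (S k)) in *. nra. }
  assert (H2 : forall n k, norm (minus (u (n + k)%nat) (u n)) <= q ^ n * M).
  { induction n; intros k; simpl.
    - rewrite Rmult_1_l; apply H1.
    - pose proof (HA (u (n + k)%nat) (u n) (Du _) (Du _)).
      specialize (IHn k). nra. }
  assert (Hsmall : forall eps : posreal, exists N, q ^ N * M < eps).
  { intros eps.
    (* The denominator [M + 1] is positive even if [M] vanishes. *)
    destruct (pow_lt_1_zero q ltac:(rewrite Rabs_pos_eq; lra) (eps / (M + 1))) as [N HN].
    { apply Rdiv_lt_0_compat; [apply eps|lra]. }
    exists N; specialize (HN N (Nat.le_refl _)).
    pose proof (pow_le q N (proj1 Hq)).
    rewrite Rabs_pos_eq in HN by assumption.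
    apply Rlt_div_r in HN; [nra|lra]. }
  destruct (proj1 (filterlim_locally_cauchy (F := eventually) u)) as [z Hz].
  { intros eps; destruct (Hsmall (pos_div_2 eps)) as [N HN].
    exists (fun n => (N <= n)%nat); split; [now exists N|].
    intros m n Hm Hn; apply (norm_compat1 (u m) (u n)).
    change (norm (minus (u n) (u m)) < eps).
    pose proof (H2 N (m - N)%nat); pose proof (H2 N (n - N)%nat).
    replace (N + (m - N))%nat with m in * by lia.
    replace (N + (n - N))%nat with n in * by lia.
    pose proof (norm_minus_triangle (u N) (u n) (u m)).
    rewrite (norm_minus_sym (u N) (u m)) in *. simpl in HN; lra. }
  assert (Dz : D z) by (refine (closed_filterlim _ D z Hz Du Dcl)).
  exists z; split; [exact Dz|].
  (* Pass through [A (u N) = u (S N)]: both [A z] and [z] are within [e / 2] of it for large [N]. *)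
  assert (H0 : norm (minus (A z) z) <= 0).
  { apply le_epsilon; intros e He.
    pose proof (proj1 (filterlim_locally_ball_norm u z) Hz
      (mkposreal (e / 2) ltac:(lra))) as [N HN].
    pose proof (HN N (Nat.le_refl _)) as Ha.
    pose proof (HN (S N) ltac:(lia)) as Hb.
    change (norm (minus (u N) z) < e / 2) in Ha.
    change (norm (minus (u (S N)) z) < e / 2) in Hb.
    pose proof (HA z (u N) Dz (Du N)).
    pose proof (norm_minus_triangle (A (u N)) (A z) z).
    change (A (u N)) with (u (S N)) in *.
    rewrite (norm_minus_sym z (u N)) in *.
    pose proof (norm_ge_0 (minus (u N) z)).
    nra. }
  destruct (Classical_Prop.classic (A z = z)) as [|Hne]; [assumption|].
  elim (Rlt_not_le _ _ (norm_minus_gt_0 _ _ Hne) H0).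
Qed.

(** * The functional, the base and Markov operators *)

Section StateSpace.

Context {X : CompleteNormedModule R_AbsRing} (P : X -> Prop) (f : X -> R).
Hypothesis HX : abstract_state_space P f.

Let f_lin : linear_map (V := X) (W := R_ModuleSpace) f := ass_linear P f HX.

Lemma functional_plus (x y : X) : f (plus x y) = f x + f y.
Proof. exact (proj1 f_lin x y). Qed.

Lemma functional_scal (a : R) (x : X) : f (scal a x) = a * f x.
Proof. exact (proj2 f_lin a x). Qed.

Lemma functional_minus (x y : X) : f (minus x y) = f x - f y.
Proof. exact (linear_map_minus (W := R_CompleteNormedModule) f x y f_lin). Qed.

(** The set where [Rabs (f u) <= 1] is convex and contains the base and its negative, hence contains
    their hull. *)
Lemma state_ball_functional (u : X) : state_ball P f u -> Rabs (f u) <= 1.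
Proof.
  intros Hu; apply (Hu (fun u => Rabs (f u) <= 1)).
  - intros x y a Hx Hy Ha; rewrite functional_plus, !functional_scal.
    apply Rabs_le_between in Hx; apply Rabs_le_between in Hy.
    apply Rabs_le_between; nra.
  - intros y [[_ Hy]|[_ Hy]].
    + rewrite Hy, Rabs_R1; lra.
    + assert (H : f (opp y) = - f y)
        by exact (linear_map_opp (W := R_CompleteNormedModule) f y f_lin).
      pose proof (eq_trans (eq_sym H) Hy); replace (f y) with (Ropp 1) by lra.
      rewrite Rabs_Ropp, Rabs_R1; lra.
Qed.

(** By the previous bound, [Rabs (f x)] is a lower bound of the scalars whose infimum is
    [norm x]. *)
Lemma functional_le_norm (x : X) : Rabs (f x) <= norm x.
Proof.
  apply (proj2 (ass_norm P f HX x) (Finite (Rabs (f x)))).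
  intros l [Hl [u [Hu ->]]]; simpl.
  rewrite functional_scal, Rabs_mult, (Rabs_pos_eq l) by exact Hl.
  pose proof (state_ball_functional u Hu); nra.
Qed.

Lemma functional_is_linear : is_linear (U := X) (V := R_NormedModule) f.
Proof.
  split.
  - exact functional_plus.
  - exact functional_scal.
  - exists 1; split; [lra|]; intros x; rewrite Rmult_1_l.
    exact (functional_le_norm x).
Qed.

Lemma norm_state (x : X) : state_base P f x -> norm x <= 1.
Proof.
  intros Hx; apply (proj1 (ass_norm P f HX x) 1); split; [lra|].
  exists x; split.
  - intros C _ HC; apply HC; now left.
  - symmetry; exact (scal_one x).
Qed.

Lemma closed_state_base : closed (state_base P f).
Proof.
  apply closed_and; [exact (ass_closed P f HX)|].
  apply (closed_comp f (fun r : R => r = 1)); [|apply closed_eq].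
  intros x; exact (linear_cont (U := X) (V := R_NormedModule) f x functional_is_linear).
Qed.

(** The preimage of the ball under [T] is convex and contains the base and its negative. *)
Lemma state_ball_markov (T : X -> X) (u : X) :
  markov P f T -> state_ball P f u -> state_ball P f (T u).
Proof.
  intros [Tl [_ TK]] Hu; apply (Hu (fun u => state_ball P f (T u))).
  - intros x y a Hx Hy Ha C HC HA.
    rewrite (proj1 Tl), !(proj2 Tl).
    apply HC; [apply Hx|apply Hy|]; assumption.
  - intros y Hy C _ HA; apply HA; destruct Hy as [Hy|Hy]; [left; auto|right].
    exact (eq_ind _ (state_base P f) (TK _ Hy) _ (linear_map_opp T y Tl)).
Qed.

(** Every scalar admissible in the gauge of [x] is admissible for [T x], because [T] preserves the
    ball. *)
Lemma markov_contraction (T : X -> X) (x : X) : markov P f T -> norm (T x) <= norm x.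
Proof.
  intros HT; apply (proj2 (ass_norm P f HX x) (Finite (norm (T x)))).
  intros l [Hl [u [Hu ->]]].
  apply (proj1 (ass_norm P f HX _)); split; [exact Hl|].
  exists (T u); split; [now apply state_ball_markov|].
  apply (proj2 (proj1 HT)).
Qed.

Lemma markov_is_linear (T : X -> X) :
  markov P f T -> is_linear (U := X) (V := X) T.
Proof.
  intros HT; destruct (HT) as [[Hp Hs] _]; split; [exact Hp|exact Hs|].
  exists 1; split; [lra|]; intros x; rewrite Rmult_1_l; exact (markov_contraction T x HT).
Qed.

Lemma cone_eq_scal_state (x : X) :
  P x -> x = zero \/ exists k, state_base P f k /\ x = scal (f x) k.
Proof.
  intros Px; destruct (Classical_Prop.classic (x = zero)) as [|Hx]; [now left|right].
  pose proof (ass_pos P f HX x Px Hx) as Hf.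
  exists (scal (/ f x) x); repeat split.
  - apply (ass_cone_scal P f HX); [apply Rlt_le, Rinv_0_lt_compat|]; assumption.
  - rewrite functional_scal; field; lra.
  - rewrite scal_assoc; change (mult (f x) (/ f x)) with (f x * / f x).
    rewrite Rinv_r by lra; symmetry; exact (scal_one x).
Qed.

(** Nonzero cone elements are multiples of states, where [f] is preserved; the cone generates the
    space. *)
Lemma markov_functional (T : X -> X) (x : X) : markov P f T -> f (T x) = f x.
Proof.
  intros [Tl [_ TK]].
  assert (Hcone : forall y, P y -> f (T y) = f y).
  { intros y Py; destruct (cone_eq_scal_state y Py) as [->|[k [Hk ->]]].
    - now rewrite (linear_map_zero T Tl).
    - rewrite (proj2 Tl), !functional_scal.
      now rewrite (proj2 (TK k Hk)), (proj2 Hk). }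
  destruct (ass_generating P f HX x) as [y [z [Py [Pz ->]]]].
  rewrite (linear_map_minus T y z Tl), !functional_minus, !Hcone by assumption.
  reflexivity.
Qed.

(** * Orbits of a semigroup and their averages *)

Section Semigroup.

Variable T : R -> X -> X.
Hypothesis HT : C0_markov_semigroup P f T.

Lemma orbit_dist (x : X) (a b : R) :
  0 <= a <= b -> norm (minus (T b x) (T a x)) <= norm (minus (T (b - a) x) x).
Proof.
  intros Hab; replace b with (a + (b - a)) at 1 by ring.
  pose proof (c0m_markov P f T HT a ltac:(lra)) as Ma.
  rewrite (c0m_add P f T HT) by lra.
  rewrite <- (linear_map_minus (T a)) by exact (proj1 Ma).
  exact (markov_contraction _ _ Ma).
Qed.

(** [Rmax 0 s] extends the orbit by a constant to negative times, where [T] is unconstrained. Both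
    one-sided estimates reduce to strong continuity at 0 by [orbit_dist]. *)
Lemma continuous_orbit (x : X) (t : R) : continuous (fun s => T (Rmax 0 s) x) t.
Proof.
  apply (filterlim_locally_ball_norm (fun s => T (Rmax 0 s) x)); intros eps.
  pose proof (proj1 (filterlim_locally _ _) (c0m_cont P f T HT x) eps) as [d Hd].
  exists d; intros s Hs.
  change (norm (minus (T (Rmax 0 s) x) (T (Rmax 0 t) x)) < eps).
  change (Rabs (s - t) < d) in Hs.
  assert (Hsmall : forall h, 0 <= h < d -> norm (minus (T h x) x) < eps).
  { intros h [[Hh|<-] Hhd].
    - specialize (Hd h).
      change (Rabs (h - 0) < d -> 0 < h -> Rabs (norm (minus (T h x) x) - 0) < eps) in Hd.
      rewrite !Rminus_0_r, (Rabs_pos_eq h) in Hd by lra.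
      specialize (Hd Hhd Hh); pose proof (Rle_abs (norm (minus (T h x) x))); lra.
    - rewrite (c0m_zero P f T HT), minus_eq_zero.
      apply Rle_lt_trans with 0; [right; exact norm_zero|apply eps]. }
  apply Rabs_lt_between in Hs.
  destruct (Rle_dec t s) as [Hts|Hts].
  - eapply Rle_lt_trans; [apply orbit_dist|apply Hsmall];
      unfold Rmax; repeat destruct (Rle_dec _ _); lra.
  - rewrite norm_minus_sym.
    eapply Rle_lt_trans; [apply orbit_dist|apply Hsmall];
      unfold Rmax; repeat destruct (Rle_dec _ _); lra.
Qed.

Lemma ex_RInt_orbit (x : X) (a b : R) :
  0 <= a <= b -> ex_RInt (fun s => T s x) a b.
Proof.
  intros Hab; apply ex_RInt_ext with (fun s => T (Rmax 0 s) x).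
  - intros s; rewrite Rmin_left by lra; intros Hs; now rewrite Rmax_right by lra.
  - apply (ex_RInt_continuous (fun s => T (Rmax 0 s) x)).
    intros z _; apply continuous_orbit.
Qed.

Lemma norm_RInt_orbit_le (x : X) (a b : R) :
  0 <= a <= b -> norm (RInt (fun s => T s x) a b) <= (b - a) * norm x.
Proof.
  intros Hab; refine (norm_RInt_le_const (fun s => T s x) a b _ _ (proj2 Hab) _ _).
  - intros s Hs; apply markov_contraction, (c0m_markov P f T HT); lra.
  - apply (RInt_correct (fun s => T s x)), ex_RInt_orbit, Hab.
Qed.

Lemma average_linear (t : R) : 0 < t -> linear_map (average T t).
Proof.
  intros Ht; unfold average.
  assert (HI : forall x, ex_RInt (fun s => T s x) 0 t)
    by (intros; apply ex_RInt_orbit; lra).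
  assert (Hlin : forall s, 0 < s < t -> linear_map (T s)).
  { intros s Hs; apply (c0m_markov P f T HT); lra. }
  split.
  - intros x y; rewrite <- scal_distr_l; f_equal.
    refine (eq_trans _ (RInt_plus (fun s => T s x) (fun s => T s y) 0 t (HI x) (HI y))).
    apply RInt_ext; intros s; rewrite Rmin_left, Rmax_right by lra; intros Hs.
    apply (Hlin s Hs).
  - intros a x.
    transitivity (scal (/ t) (scal a (RInt (fun s => T s x) 0 t)));
      [f_equal|rewrite !scal_assoc; f_equal; exact (Rmult_comm _ _)].
    refine (eq_trans _ (RInt_scal (fun s => T s x) 0 t a (HI x))).
    apply RInt_ext; intros s; rewrite Rmin_left, Rmax_right by lra; intros Hs.
    apply (Hlin s Hs).
Qed.

Lemma is_RInt_average (t : R) (x : X) :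
  0 < t -> is_RInt (fun s => T s x) 0 t (scal t (average T t x)).
Proof.
  intros Ht; unfold average.
  rewrite scal_assoc; change (mult t (/ t)) with (t * / t).
  rewrite Rinv_r by lra.
  replace (scal 1 (RInt (fun s => T s x) 0 t)) with (RInt (fun s => T s x) 0 t)
    by (symmetry; exact (scal_one _)).
  apply (RInt_correct (fun s => T s x)), ex_RInt_orbit; lra.
Qed.

Lemma average_unique (t : R) (x v : X) :
  0 < t -> is_RInt (fun s => T s x) 0 t (scal t v) -> average T t x = v.
Proof.
  intros Ht Hv; unfold average; rewrite (is_RInt_unique _ _ _ _ Hv).
  rewrite scal_assoc; change (mult (/ t) t) with (/ t * t).
  rewrite Rinv_l by lra; exact (scal_one v).
Qed.

(** [f] is bounded and linear, so it passes under the integral, where [f (T s x)] is constantly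
    [f x]. *)
Lemma average_functional (t : R) (x : X) : 0 < t -> f (average T t x) = f x.
Proof.
  intros Ht.
  pose proof (is_RInt_linear (V := X) (W := R_NormedModule) f _ _ _ _
    functional_is_linear (is_RInt_average t x Ht)) as HI.
  assert (HJ : is_RInt (fun s => f (T s x)) 0 t (t * f x)).
  { apply is_RInt_ext with (fun _ => f x).
    - intros s; rewrite Rmin_left, Rmax_right by lra; intros Hs.
      symmetry; apply markov_functional, (c0m_markov P f T HT); lra.
    - replace (t * f x) with ((t - 0) * f x) by ring.
      exact (is_RInt_const 0 t (f x : R_NormedModule)). }
  assert (E : f (scal t (average T t x)) = t * f x)
    by exact (eq_trans
      (eq_sym (is_RInt_unique (V := R_CompleteNormedModule) _ _ _ _ HI))
      (is_RInt_unique (V := R_CompleteNormedModule) _ _ _ _ HJ)).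
  rewrite functional_scal in E; apply Rmult_eq_reg_l with t; lra.
Qed.

Lemma average_markov (t : R) : 0 < t -> markov P f (average T t).
Proof.
  intros Ht.
  assert (Hpos : forall x, P x -> P (average T t x)).
  { intros x Px; unfold average.
    apply (ass_cone_scal P f HX); [now apply Rlt_le, Rinv_0_lt_compat|].
    refine (is_RInt_cone P (fun s => T s x) 0 t _ (ass_cone_zero P f HX)
      (ass_cone_plus P f HX) (ass_cone_scal P f HX) (ass_closed P f HX) Ht _ _).
    - intros s Hs; destruct (c0m_markov P f T HT s (proj1 Hs)) as [_ [Tpos _]]; exact (Tpos x Px).
    - apply (RInt_correct (fun s => T s x)), ex_RInt_orbit; lra. }
  split; [now apply average_linear|split; [exact Hpos|]].
  intros x [Px fx]; split; [now apply Hpos|].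
  now rewrite average_functional.
Qed.

Lemma average_fixed_point (t : R) (x : X) :
  0 < t -> fixed_point T x -> average T t x = x.
Proof.
  intros Ht Hx; apply average_unique; [exact Ht|].
  apply is_RInt_ext with (fun _ => x).
  - intros s; rewrite Rmin_left by lra; intros Hs; symmetry; apply Hx; lra.
  - replace t with (t - 0) at 2 by ring; exact (is_RInt_const 0 t x).
Qed.

(** [T s] passes under the integral, and it commutes with every [T r] by additivity of times. *)
Lemma average_commute (t s : R) (x : X) :
  0 < t -> 0 <= s -> average T t (T s x) = T s (average T t x).
Proof.
  intros Ht Hs; apply average_unique; [exact Ht|].
  pose proof (c0m_markov P f T HT s Hs) as Ms.
  rewrite <- (proj2 (proj1 Ms)).
  apply is_RInt_ext with (fun r => T s (T r x)).
  - intros r; rewrite Rmin_left by lra; intros Hr.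
    rewrite <- !(c0m_add P f T HT) by lra; f_equal; ring.
  - apply (is_RInt_linear (V := X) (W := X) (T s)); [now apply markov_is_linear|].
    now apply is_RInt_average.
Qed.

(** * Cancellation estimates for averages *)

(** The integrals over [[0, t]] and [[s, t + s]] differ by those over [[0, s]] and [[t, t + s]],
    each of norm at most [s * norm y]. *)
Lemma norm_average_minus_shift (t s : R) (y : X) :
  0 < t -> 0 <= s ->
  norm (average T t (minus y (T s y))) <= 2 * s / t * norm y.
Proof.
  intros Ht Hs.
  rewrite linear_map_minus by now apply average_linear.
  unfold average; rewrite <- scal_minus.
  assert (Hi : 0 < / t) by now apply Rinv_0_lt_compat.
  eapply Rle_trans; [apply norm_scal_nonneg; lra|].
  replace (2 * s / t * norm y) with (/ t * (2 * s * norm y)) by (field; lra).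
  apply Rmult_le_compat_l; [lra|].
  assert (E : RInt (fun r => T r (T s y)) 0 t = RInt (fun r => T r y) s (t + s)).
  { assert (E0 := RInt_comp_lin (fun r => T r y) 1 s 0 t
      (ex_RInt_orbit y (1 * 0 + s) (1 * t + s) ltac:(lra))).
    replace (1 * 0 + s) with s in E0 by ring.
    replace (1 * t + s) with (t + s) in E0 by ring.
    rewrite <- E0; apply RInt_ext; intros r; rewrite Rmin_left by lra; intros Hr.
    rewrite <- (c0m_add P f T HT) by lra.
    replace (1 * r + s) with (r + s) by ring; symmetry; exact (scal_one _). }
  rewrite E.
  (* Both sides come from splitting the integral over [[0, t + s]], at [s] and at [t], so no order
     between [s] and [t] is assumed. *)
  assert (E2 : minus (RInt (fun r => T r y) 0 t) (RInt (fun r => T r y) s (t + s))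
    = minus (RInt (fun r => T r y) 0 s) (RInt (fun r => T r y) t (t + s))).
  { set (g := fun r => T r y).
    assert (C1 : plus (RInt g 0 s) (RInt g s (t + s)) = RInt g 0 (t + s))
      by (apply RInt_Chasles; apply ex_RInt_orbit; lra).
    assert (C2 : plus (RInt g 0 t) (RInt g t (t + s)) = RInt g 0 (t + s))
      by (apply RInt_Chasles; apply ex_RInt_orbit; lra).
    exact (minus_eq_minus _ _ _ _ (eq_trans C2 (eq_sym C1))). }
  rewrite E2; eapply Rle_trans; [apply norm_minus_le|].
  pose proof (norm_RInt_orbit_le y 0 s ltac:(lra)).
  pose proof (norm_RInt_orbit_le y t (t + s) ltac:(lra)). lra.
Qed.

(** The vector [y - A_{t0} y] is the mean of [y - T s y] over [s] in [[0, t0]]; the shift estimate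
    applies under the integral with [s <= t0]. *)
Lemma norm_average_minus_average (t t0 : R) (y : X) :
  0 < t -> 0 < t0 ->
  norm (average T t (minus y (average T t0 y))) <= 2 * t0 / t * norm y.
Proof.
  intros Ht Ht0.
  pose proof (average_markov t Ht) as Mt.
  assert (HI : is_RInt (fun s => average T t (minus y (T s y))) 0 t0
    (average T t (scal t0 (minus y (average T t0 y))))).
  { apply (is_RInt_linear (V := X) (W := X)); [now apply markov_is_linear|].
    rewrite scal_minus.
    apply (is_RInt_minus (V := X) (fun _ => y)); [|now apply is_RInt_average].
    replace t0 with (t0 - 0) at 2 by ring; exact (is_RInt_const 0 t0 y). }
  apply Rmult_le_reg_l with t0; [exact Ht0|].
  eapply Rle_trans; [apply norm_scal_inv, Ht0|].
  rewrite <- (proj2 (proj1 Mt)).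
  replace (t0 * (2 * t0 / t * norm y)) with ((t0 - 0) * (2 * t0 / t * norm y)) by ring.
  refine (norm_RInt_le_const _ 0 t0 _ _ (Rlt_le _ _ Ht0) _ HI).
  intros s Hs; eapply Rle_trans; [apply norm_average_minus_shift; lra|].
  apply Rmult_le_compat_r; [apply norm_ge_0|].
  apply Rmult_le_compat_r; [apply Rlt_le, Rinv_0_lt_compat, Ht|lra].
Qed.

(** * Semigroups whose average at [t0] contracts the kernel of [f] *)

Variables (t0 q : R).
Hypothesis Ht0 : 0 < t0.
Hypothesis Hq : 0 <= q < 1.
Hypothesis Hker : forall w, f w = 0 -> norm (average T t0 w) <= q * norm w.

Lemma norm_average_kernel_le (t : R) (w : X) :
  0 < t -> f w = 0 -> norm (average T t w) <= 2 * t0 / t / (1 - q) * norm w.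
Proof.
  intros Ht fw; set (e := 2 * t0 / t / (1 - q)).
  (* [e] is the solution of [e = 2 * t0 / t + q * e], the limit of the iterated bound. *)
  assert (He : 2 * t0 / t = e * (1 - q)) by (unfold e; field; lra).
  (* The case [n = 0] is contractivity of the average. The inductive step rests on [e * (1 - q) + (e
     + q ^ n) * q = e + q ^ S n]. *)
  assert (Hn : forall n w, f w = 0 -> norm (average T t w) <= (e + q ^ n) * norm w).
  { assert (0 <= e) by (unfold e; apply Rlt_le; repeat apply Rdiv_lt_0_compat; lra).
    intros n; induction n as [|n IHn]; intros v fv.
    - pose proof (markov_contraction _ v (average_markov t Ht)).
      pose proof (norm_ge_0 v). simpl; nra.
    - set (v' := average T t0 v).
      assert (fv' : f v' = 0) by (unfold v'; rewrite average_functional; auto).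
      assert (E : average T t v = plus (average T t (minus v v')) (average T t v')).
      { rewrite linear_map_minus by now apply average_linear.
        symmetry; exact (plus_minus_cancel (average T t v) (average T t v')). }
      rewrite E.
      apply Rle_trans with (norm (average T t (minus v v')) + norm (average T t v'));
        [exact (norm_triangle _ _)|].
      pose proof (norm_average_minus_average t t0 v Ht Ht0) as H1.
      fold v' in H1; rewrite He in H1.
      pose proof (IHn v' fv') as H2.
      pose proof (Hker v fv) as H3; fold v' in H3.
      pose proof (pow_le q n (proj1 Hq)) as H4.
      assert (H5 : (e + q ^ n) * norm v' <= (e + q ^ n) * (q * norm v))
        by (apply Rmult_le_compat_l; [lra|exact H3]).
      simpl; lra. }
  (* Let [n] grow until [q ^ n * norm w] is below [d]. *)
  apply le_epsilon; intros d Hd.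
  pose proof (norm_ge_0 w) as Hw.
  destruct (pow_lt_1_zero q ltac:(rewrite Rabs_pos_eq; lra) (d / (norm w + 1))) as [N HN].
  { apply Rdiv_lt_0_compat; lra. }
  specialize (HN N (Nat.le_refl _)); pose proof (pow_le q N (proj1 Hq)).
  rewrite Rabs_pos_eq in HN by assumption.
  apply Rlt_div_r in HN; [|lra].
  pose proof (Hn N w fw); nra.
Qed.

(** The state [x] starts the iteration. Uniqueness passes from the average to the semigroup because
    fixed points of the semigroup are fixed by the average. *)
Lemma exists_unique_fixed_state (x : X) :
  state_base P f x -> exists z, unique_fixed_state P f T z.
Proof.
  intros Kx; pose proof (average_markov t0 Ht0) as MA.
  assert (HA : forall y z, state_base P f y -> state_base P f z ->
    norm (minus (average T t0 y) (average T t0 z)) <= q * norm (minus y z)).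
  { intros y z [_ fy] [_ fz].
    rewrite <- linear_map_minus by exact (proj1 MA).
    apply Hker; rewrite functional_minus, fy, fz; ring. }
  assert (Hu : forall y z, state_base P f y -> state_base P f z ->
    average T t0 y = y -> average T t0 z = z -> y = z).
  { intros y z Ky Kz Ey Ez.
    destruct (Classical_Prop.classic (y = z)) as [|Hne]; [assumption|].
    pose proof (HA y z Ky Kz) as H; rewrite Ey, Ez in H.
    assert (0 < norm (minus y z)) by exact (norm_minus_gt_0 y z Hne). nra. }
  destruct (contraction_fixed_point (state_base P f) (average T t0) q x
    closed_state_base Hq Kx (proj2 (proj2 MA)) HA) as [z [Kz Ez]].
  exists z; split; [split; [exact Kz|]|].
  (* By commutation [T t z] is again a state fixed by the average, so it equals [z]. *)
  - intros t Ht; apply Hu; auto.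
    + now apply (c0m_markov P f T HT).
    + rewrite average_commute, Ez by assumption; reflexivity.
  - intros y [Ky Hy]; apply Hu; auto; now apply average_fixed_point.
Qed.

Lemma fixed_state_uniformly_mean_ergodic (z : X) :
  state_base P f z -> fixed_point T z -> uniformly_mean_ergodic P f T.
Proof.
  intros Kz Hz; exists z; split; [exact Kz|].
  set (L (t : R) (x : X) := minus (average T t x) (scal (f x) z)).
  (* The kernel estimate gives [2 * t0 / (1 - q)]; another factor 2 bounds the norm of [x - f(x) z]
     by [2 * norm x]. *)
  set (c := 4 * t0 / (1 - q)).
  assert (HL : forall t x, 0 < t -> norm (L t x) <= c / t * norm x).
  { intros t x Ht; unfold L.
    (* Since the average fixes [z], [L t x] is the average of a vector in the kernel of [f]. *)
    assert (E : minus (average T t x) (scal (f x) z)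
      = average T t (minus x (scal (f x) z))).
    { pose proof (average_linear t Ht) as Hl.
      rewrite (linear_map_minus _ _ _ Hl), (proj2 Hl), (average_fixed_point t z Ht Hz).
      reflexivity. }
    rewrite E.
    eapply Rle_trans; [apply norm_average_kernel_le; [exact Ht|]|].
    - rewrite functional_minus, functional_scal, (proj2 Kz); ring.
    - replace (c / t) with (2 * t0 / t / (1 - q) * 2) by (unfold c; field; lra).
      rewrite Rmult_assoc; apply Rmult_le_compat_l.
      + apply Rlt_le; repeat apply Rdiv_lt_0_compat; lra.
      + eapply Rle_trans; [apply norm_minus_le|].
        assert (norm (scal (f x) z) <= Rabs (f x) * norm z) by exact (norm_scal _ _).
        pose proof (functional_le_norm x); pose proof (norm_state z Kz).
        assert (0 <= norm z) by apply norm_ge_0.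
        pose proof (Rabs_pos (f x)). nra. }
  assert (Hc : forall t, 0 < t -> 0 <= c / t).
  { intros t Ht; apply Rlt_le; unfold c; repeat apply Rdiv_lt_0_compat; lra. }
  apply is_lim_le_le_loc with (fun _ => 0) (fun t => c / t).
  - exists 0; intros t Ht; split.
    + exact (op_norm_ge0 (L t) _ (fun x => HL t x Ht) (Hc t Ht)).
    + exact (op_norm_le (L t) _ (fun x => HL t x Ht) (Hc t Ht)).
  - apply is_lim_const.
  - replace (Finite 0) with (Rbar_mult (Finite c) (Rbar_inv p_infty))
      by (simpl; f_equal; ring).
    apply is_lim_scal_l, is_lim_inv; [apply is_lim_id|discriminate].
Qed.

End Semigroup.

End StateSpace.

(** * Stability of the fixed state under perturbation *)

Theorem theorem4p4 :
  forall (X : CompleteNormedModule R_AbsRing) (P : X -> Prop) (f : X -> R),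
  strong_abstract_state_space P f ->
  forall (T : R -> X -> X) (t0 : R),
  C0_markov_semigroup P f T ->
  0 < t0 ->
  dobrushin f (average T t0) < 1 ->
  forall x0 : X,
  unique_fixed_state P f T x0 ->
  forall S : R -> X -> X,
  C0_markov_semigroup P f S ->
  op_norm (fun x : X => minus (average S t0 x) (average T t0 x))
    < 1 - dobrushin f (average T t0) ->
  uniformly_mean_ergodic P f S /\
  exists z0 : X,
    unique_fixed_state P f S z0 /\
    norm (minus x0 z0) <=
      op_norm (fun x : X => minus (average S t0 x) (average T t0 x)) /
      (1 - dobrushin f (average T t0)
         - op_norm (fun x : X => minus (average S t0 x) (average T t0 x))).
Proof.
  intros X P f [HX _] T t0 HT Ht0 Hd x0 [[Kx0 Fx0] _] S HS Heta.
  pose proof (average_markov P f HX T HT t0 Ht0) as MT.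
  pose proof (average_markov P f HX S HS t0 Ht0) as MS.
  set (A := average S t0) in *; set (B := average T t0) in *.
  (* The crude constants 1 and 2 make the suprema behind [dobrushin] and [op_norm] finite. *)
  assert (HB : forall x, norm (B x) <= 1 * norm x).
  { intros x; rewrite Rmult_1_l; exact (markov_contraction P f HX B x MT). }
  assert (HD : forall x, norm (minus (A x) (B x)) <= 2 * norm x).
  { intros x; eapply Rle_trans; [apply norm_minus_le|].
    pose proof (markov_contraction P f HX A x MS); specialize (HB x); lra. }
  assert (LD : linear_map (fun x => minus (A x) (B x))).
  { destruct MS as [[Ap As] _], MT as [[Bp Bs] _]; split.
    - intros x y; rewrite Ap, Bp; exact (minus_plus_plus (A x) (A y) (B x) (B y)).
    - intros a x; rewrite As, Bs; symmetry; exact (scal_minus a (A x) (B x)). }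
  set (eta := op_norm (fun x : X => minus (A x) (B x))) in *.
  assert (He0 : 0 <= eta)
    by exact (op_norm_ge0 (fun x => minus (A x) (B x)) 2 HD ltac:(lra)).
  pose proof (dobrushin_ge0 B f 1 HB) as Hd0.
  assert (HDn : forall x, norm (minus (A x) (B x)) <= eta * norm x).
  { intros x; exact (norm_le_op_norm (fun x => minus (A x) (B x)) 2 x LD HD ltac:(lra)). }
  set (delta := dobrushin f B) in *.
  assert (Hker : forall w, f w = 0 -> norm (A w) <= (delta + eta) * norm w).
  { intros w fw.
    pose proof (norm_le_dobrushin B f 1 w HB fw) as H1; fold delta in H1.
    specialize (HDn w).
    assert (H2 : norm (A w) <= norm (minus (A w) (B w)) + norm (B w)).
    { rewrite <- (plus_minus_cancel (A w) (B w) : _ = A w) at 1.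
      exact (norm_triangle _ _). }
    lra. }
  assert (Hq : 0 <= delta + eta < 1) by lra.
  destruct (exists_unique_fixed_state P f HX S HS t0 (delta + eta) Ht0 Hq Hker x0 Kx0)
    as [z0 Hz0].
  destruct (Hz0) as [[Kz0 Fz0] _].
  split.
  - exact (fixed_state_uniformly_mean_ergodic P f HX S HS t0 _ Ht0 Hq Hker z0 Kz0 Fz0).
  - exists z0; split; [exact Hz0|].
    (* The denominator is [1 - (delta + eta)], positive by [Hq]; the product form follows from [H1],
       [H2], [H3] and [norm x0 <= 1]. *)
    apply Rle_div_r; [lra|].
    pose proof (average_fixed_point S t0 z0 Ht0 Fz0) as EA; fold A in EA.
    pose proof (average_fixed_point T t0 x0 Ht0 Fx0) as EB; fold B in EB.
    assert (H1 : norm (A (minus x0 z0)) <= (delta + eta) * norm (minus x0 z0)).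
    { apply Hker; rewrite (functional_minus P f HX), (proj2 Kx0), (proj2 Kz0); ring. }
    rewrite (linear_map_minus A _ _ (proj1 MS)), EA in H1.
    pose proof (norm_minus_triangle (A x0) x0 z0) as H2.
    pose proof (HDn x0) as H3; rewrite EB, norm_minus_sym in H3.
    pose proof (norm_state P f HX x0 Kx0). nra.
Qed.
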